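(* Let $u\in(0,1)$ and $\mathscr{C}_n^u:=F^{-(n-1)}[u,1]$ for $n\ge1$. Then the sequence $(\lambda(\mathscr{C}_n^u))_{n\ge1}$ is decreasing.
   Context: $\lambda$ denotes Lebesgue measure on $[0,1]$. $F:[0,1]\to[0,1]$ is the Farey map, $F(x)=x/(1-x)$ for $0\le x\le 1/2$ and $F(x)=(1-x)/x$ for $1/2<x\le 1$; $F^{-k}$ denotes preimage under the $k$-th iterate. *)

(* Defs.v *)
From Stdlib Require Import Reals ClassicalEpsilon.
Open Scope R_scope.

Definition farey (x : R) : R :=
  if Rle_dec x (1/2) then x / (1 - x) else (1 - x) / x.

Definition farey_iter (k : nat) (x : R) : R := Nat.iter k farey x.

Definition farey_preimage (k : nat) (A : R -> Prop) (x : R) : Prop :=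
  0 <= x <= 1 /\ A (farey_iter k x).

Definition Cset (u : R) (n : nat) : R -> Prop :=
  farey_preimage (n - 1) (fun y => u <= y <= 1).

(* Lebesgue (outer) measure: infimum of total lengths of countable covers
   by open intervals (a_i, b_i) with summable lengths. *)
Definition cover_sum (A : R -> Prop) (s : R) : Prop :=
  exists a b : nat -> R,
    (forall i, a i <= b i) /\
    (forall x, A x -> exists i, a i < x < b i) /\
    infinite_sum (fun i => b i - a i) s.

Definition is_glb_R (P : R -> Prop) (m : R) : Prop :=
  (forall r, P r -> m <= r) /\ (forall m', (forall r, P r -> m' <= r) -> m' <= m).

Definition lebesgue (A : R -> Prop) : R :=
  epsilon (inhabits 0) (fun m => is_glb_R (cover_sum A) m).

(* Main.v *)
Require Import Defs.
From Stdlib Require Import Reals Lra Lia Psatz ClassicalEpsilon FunctionalExtensionality PropExtensionality.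
Open Scope R_scope.

(* For [0 < t <= 1] let [psi t z = t z / (1 - (1 - t) z)], an increasing bijection
   of [0,1] onto itself, and [a = t / (1 + t)].  The Farey map conjugates [psi t]
   to [psi a] (rescaled) on [0, 1 - a] and to [psi (1 - a)] (rescaled and
   reflected) on [1 - a, 1].  Hence the measure of [psi t ^-1 (F^-k [u,1])] is
   [V_k t * lambda [0,1]] ([V_k = farey_mass u k]) with [V_0 t = t / (c + t)],
   [c = u / (1 - u)], and [V_(k+1) t = (1 - a) V_k a + a V_k (1 - a)].  This
   recursion preserves being nondecreasing and concave on [0,1], and
   [C_(k+1) = psi 1 ^-1 (F^-k [u,1])], so [V_(k+1) 1 = V_k (1/2) <= V_k 1]
   gives the monotonicity. *)

Lemma Rle_div_r a N D : 0 < D -> (a <= N / D <-> a * D <= N).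
Proof.
  intros HD. split; intro H.
  - apply Rmult_le_compat_r with (r := D) in H; [|lra].
    unfold Rdiv in H. rewrite Rmult_assoc, Rinv_l, Rmult_1_r in H by lra. exact H.
  - apply Rmult_le_reg_r with D; [exact HD|].
    unfold Rdiv. rewrite Rmult_assoc, Rinv_l, Rmult_1_r by lra. exact H.
Qed.

Lemma Rdiv_le_l b N D : 0 < D -> (N / D <= b <-> N <= b * D).
Proof.
  intros HD. split; intro H.
  - apply Rmult_le_compat_r with (r := D) in H; [|lra].
    unfold Rdiv in H. rewrite Rmult_assoc, Rinv_l, Rmult_1_r in H by lra. exact H.
  - apply Rmult_le_reg_r with D; [exact HD|].
    unfold Rdiv. rewrite Rmult_assoc, Rinv_l, Rmult_1_r by lra. exact H.
Qed.

Lemma Rdiv_ge0 N D : 0 <= N -> 0 < D -> 0 <= N / D.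
Proof. intros HN HD. apply Rle_div_r; lra. Qed.

(** * Series *)

Lemma Un_cv_const c : Un_cv (fun _ => c) c.
Proof. intros e He. exists O. intros. unfold Rdist. rewrite Rminus_diag, Rabs_R0. lra. Qed.

Lemma infinite_sum_ext f g s :
  (forall i, f i = g i) -> infinite_sum f s -> infinite_sum g s.
Proof. intros E. apply Un_cv_ext. intro n. apply sum_eq. auto. Qed.

Lemma infinite_sum_ge0 f s : (forall i, 0 <= f i) -> infinite_sum f s -> 0 <= s.
Proof.
  intros Hf Hs. apply (Rle_cv_lim (Un := fun _ => 0) (Vn := fun n => sum_f_R0 f n)).
  - intro n. apply cond_pos_sum, Hf.
  - apply Un_cv_const.
  - exact Hs.
Qed.

Lemma infinite_sum_scal c f s :
  infinite_sum f s -> infinite_sum (fun i => c * f i) (c * s).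
Proof.
  intro Hs. apply (Un_cv_ext (fun n => c * sum_f_R0 f n)).
  - intro n. rewrite scal_sum. apply sum_eq. intros; ring.
  - exact (CV_mult _ _ _ _ (Un_cv_const c) Hs).
Qed.

Lemma infinite_sum_head L :
  infinite_sum (fun i => match i with O => L | S _ => 0 end) L.
Proof.
  apply (Un_cv_ext (fun _ => L)); [|apply Un_cv_const].
  induction n as [|n IH]; [reflexivity|]. rewrite tech5, <- IH. ring.
Qed.

Definition interleave (f g : nat -> R) (n : nat) : R :=
  if Nat.even n then f (Nat.div2 n) else g (Nat.div2 n).

Lemma interleave_even f g n : interleave f g (2 * n) = f n.
Proof. unfold interleave. rewrite Nat.even_mul, Nat.div2_double. reflexivity. Qed.

Lemma interleave_odd f g n : interleave f g (S (2 * n)) = g n.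
Proof.
  unfold interleave. rewrite Nat.even_succ, Nat.odd_mul, Nat.div2_succ_double.
  reflexivity.
Qed.

Lemma sum_interleave_odd f g n :
  sum_f_R0 (interleave f g) (S (2 * n)) = sum_f_R0 f n + sum_f_R0 g n.
Proof.
  induction n as [|n IH].
  - unfold interleave. simpl. ring.
  - replace (S (2 * S n)) with (S (S (S (2 * n)))) by lia.
    rewrite tech5, tech5, IH.
    replace (S (S (2 * n))) with (2 * S n)%nat by lia.
    rewrite interleave_even, interleave_odd, (tech5 f), (tech5 g). ring.
Qed.

Lemma sum_interleave_even f g n :
  sum_f_R0 (interleave f g) (2 * S n) = sum_f_R0 f (S n) + sum_f_R0 g n.
Proof.
  replace (2 * S n)%nat with (S (S (2 * n))) by lia.
  rewrite tech5, sum_interleave_odd.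
  replace (S (S (2 * n))) with (2 * S n)%nat by lia.
  rewrite interleave_even, tech5. ring.
Qed.

Lemma infinite_sum_interleave f g X Y :
  infinite_sum f X -> infinite_sum g Y -> infinite_sum (interleave f g) (X + Y).
Proof.
  intros Hf Hg e He.
  destruct (Hf (e / 2)) as [N1 H1]; [lra|].
  destruct (Hg (e / 2)) as [N2 H2]; [lra|].
  exists (2 * S (Nat.max N1 N2))%nat. intros m Hm.
  assert (Hsplit : forall n1 n2, (n1 >= N1)%nat -> (n2 >= N2)%nat ->
            Rdist (sum_f_R0 f n1 + sum_f_R0 g n2) (X + Y) < e).
  { intros n1 n2 Hn1 Hn2. eapply Rle_lt_trans; [apply Rdist_plus|].
    specialize (H1 n1 Hn1). specialize (H2 n2 Hn2). lra. }
  destruct (Nat.Even_or_Odd m) as [[k Hk]|[k Hk]]; subst m.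
  - destruct k as [|k]; [lia|]. rewrite sum_interleave_even. apply Hsplit; lia.
  - replace (2 * k + 1)%nat with (S (2 * k)) by lia.
    rewrite sum_interleave_odd. apply Hsplit; lia.
Qed.

(** * Lebesgue outer measure *)

Definition bounded (A : R -> Prop) : Prop := exists M, forall x, A x -> Rabs x <= M.

Lemma bounded_union A B : bounded A -> bounded B -> bounded (fun x => A x \/ B x).
Proof.
  intros [M HM] [N HN]. exists (Rmax M N).
  intros x [Hx|Hx]; eapply Rle_trans; [apply HM, Hx|apply Rmax_l|apply HN, Hx|apply Rmax_r].
Qed.

Lemma bounded_affine A p c :
  c <> 0 -> bounded A -> bounded (fun z => A ((z - p) / c)).
Proof.
  intros Hc [M HM]. exists (Rabs p + Rabs c * M). intros z Hz.
  replace z with (p + c * ((z - p) / c)) by (field; exact Hc).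
  eapply Rle_trans; [apply Rabs_triang|]. rewrite Rabs_mult.
  apply Rplus_le_compat_l, Rmult_le_compat_l; [apply Rabs_pos|apply HM, Hz].
Qed.

Lemma cover_sum_ge0 A s : cover_sum A s -> 0 <= s.
Proof.
  intros [a [b [Hab [_ Hs]]]]. refine (infinite_sum_ge0 _ _ _ Hs).
  intro i. specialize (Hab i). lra.
Qed.

Lemma cover_sum_mono A B s : (forall x, A x -> B x) -> cover_sum B s -> cover_sum A s.
Proof.
  intros HAB [a [b [Hab [Hcov Hs]]]]. exists a, b. repeat split; auto.
Qed.

Lemma cover_sum_interval a b : a <= b -> cover_sum (fun x => a < x < b) (b - a).
Proof.
  intros Hab. exists (fun _ => a), (fun i => match i with O => b | S _ => a end).
  split; [intros [|i]; lra|]. split.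
  - intros x Hx. exists O. exact Hx.
  - eapply infinite_sum_ext; [|apply infinite_sum_head]. intros [|i]; simpl; ring.
Qed.

Lemma cover_sum_union A B s1 s2 :
  cover_sum A s1 -> cover_sum B s2 -> cover_sum (fun x => A x \/ B x) (s1 + s2).
Proof.
  intros [a [b [Hab [Hcov Hs]]]] [a' [b' [Hab' [Hcov' Hs']]]].
  exists (interleave a a'), (interleave b b').
  split; [intro i; unfold interleave; destruct (Nat.even i); auto|]. split.
  - intros x [Hx|Hx].
    + destruct (Hcov _ Hx) as [i Hi]. exists (2 * i)%nat. rewrite !interleave_even. exact Hi.
    + destruct (Hcov' _ Hx) as [i Hi]. exists (S (2 * i)). rewrite !interleave_odd. exact Hi.
  - eapply infinite_sum_ext; [|apply (infinite_sum_interleave _ _ _ _ Hs Hs')].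
    intro i. unfold interleave. destruct (Nat.even i); reflexivity.
Qed.

Lemma cover_sum_affine A p c s :
  c <> 0 -> cover_sum A s -> cover_sum (fun z => A ((z - p) / c)) (Rabs c * s).
Proof.
  intros Hc [a [b [Hab [Hcov Hs]]]].
  assert (Hz : forall z, z = p + c * ((z - p) / c)) by (intro; field; exact Hc).
  destruct (Rlt_or_le c 0) as [Hneg|Hpos].
  - exists (fun i => p + c * b i), (fun i => p + c * a i).
    split; [intro i; specialize (Hab i); nra|]. split.
    + intros z Hz'. destruct (Hcov _ Hz') as [i Hi]. exists i. rewrite (Hz z). nra.
    + rewrite Rabs_left by exact Hneg.
      eapply infinite_sum_ext; [|apply (infinite_sum_scal (- c) _ _ Hs)].
      intro i. simpl. ring.
  - assert (Hc0 : 0 < c) by lra.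
    exists (fun i => p + c * a i), (fun i => p + c * b i).
    split; [intro i; specialize (Hab i); nra|]. split.
    + intros z Hz'. destruct (Hcov _ Hz') as [i Hi]. exists i. rewrite (Hz z). nra.
    + rewrite Rabs_right by lra.
      eapply infinite_sum_ext; [|apply (infinite_sum_scal c _ _ Hs)].
      intro i. simpl. ring.
Qed.

Lemma cover_sum_exists A : bounded A -> exists s, cover_sum A s.
Proof.
  intros [M HM]. set (K := Rabs M + 1).
  exists (K - - K). apply (cover_sum_mono _ (fun x => - K < x < K)).
  - intros x Hx. specialize (HM x Hx). pose proof (Rle_abs M). unfold K.
    unfold Rabs in HM. destruct Rcase_abs; lra.
  - apply cover_sum_interval. unfold K. pose proof (Rabs_pos M). lra.
Qed.

Lemma lebesgue_is_glb A : bounded A -> is_glb_R (cover_sum A) (lebesgue A).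
Proof.
  intro HA. unfold lebesgue. apply epsilon_spec.
  set (E := fun x => cover_sum A (- x)).
  assert (HE : bound E).
  { exists 0. intros x Hx. apply cover_sum_ge0 in Hx. lra. }
  assert (HE2 : exists x, E x).
  { destruct (cover_sum_exists A HA) as [s Hs]. exists (- s).
    unfold E. rewrite Ropp_involutive. exact Hs. }
  destruct (completeness E HE HE2) as [l [Hub Hleast]].
  exists (- l). split.
  - intros r Hr. assert (E (- r)) by (unfold E; rewrite Ropp_involutive; exact Hr).
    specialize (Hub _ H). lra.
  - intros m Hm. enough (l <= - m) by lra.
    apply Hleast. intros x Hx. specialize (Hm _ Hx). lra.
Qed.

Lemma lebesgue_le_cover A s : bounded A -> cover_sum A s -> lebesgue A <= s.
Proof. intros HA Hs. exact (proj1 (lebesgue_is_glb A HA) s Hs). Qed.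

Lemma lebesgue_ge A v :
  bounded A -> (forall s, cover_sum A s -> v <= s) -> v <= lebesgue A.
Proof. intros HA H. exact (proj2 (lebesgue_is_glb A HA) v H). Qed.

Lemma lebesgue_ge0 A : bounded A -> 0 <= lebesgue A.
Proof. intro HA. apply lebesgue_ge; [exact HA|]. apply cover_sum_ge0. Qed.

Lemma lebesgue_ext A B : (forall x, A x <-> B x) -> lebesgue A = lebesgue B.
Proof.
  intro HAB. f_equal. apply functional_extensionality. intro x.
  apply propositional_extensionality, HAB.
Qed.

Lemma lebesgue_le_of_cover_scaling A B k : bounded A -> bounded B -> 0 < k ->
  (forall s, cover_sum A s -> cover_sum B (k * s)) -> lebesgue B <= k * lebesgue A.
Proof.
  intros HA HB Hk H.
  enough (lebesgue B / k <= lebesgue A) by (apply Rdiv_le_l in H0; lra).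
  apply lebesgue_ge; [exact HA|]. intros s Hs.
  apply Rdiv_le_l; [exact Hk|].
  pose proof (lebesgue_le_cover B (k * s) HB (H s Hs)). lra.
Qed.

Lemma lebesgue_affine A p c f : c <> 0 -> bounded A ->
  (forall z, f z = (z - p) / c) -> lebesgue (fun z => A (f z)) = Rabs c * lebesgue A.
Proof.
  intros Hc HA Hf.
  assert (Ef : (fun z => A (f z)) = (fun z => A ((z - p) / c))).
  { apply functional_extensionality. intro z. rewrite Hf. reflexivity. }
  rewrite Ef. clear f Hf Ef.
  assert (Hcp : 0 < Rabs c) by (apply Rabs_pos_lt, Hc).
  assert (HAc := bounded_affine A p c Hc HA).
  apply Rle_antisym.
  - apply lebesgue_le_of_cover_scaling; auto. intros s. apply cover_sum_affine, Hc.
  - enough (lebesgue A <= / Rabs c * lebesgue (fun z => A ((z - p) / c))).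
    { apply (Rmult_le_compat_l (Rabs c)) in H; [|lra].
      rewrite <- Rmult_assoc, Rinv_r, Rmult_1_l in H by lra. exact H. }
    apply lebesgue_le_of_cover_scaling; auto; [apply Rinv_0_lt_compat, Hcp|].
    intros s Hs. rewrite <- Rabs_inv.
    apply (cover_sum_mono _ (fun y => A (((y - - p / c) / / c - p) / c))).
    + intros y Hy. replace (((y - - p / c) / / c - p) / c) with y by (field; exact Hc). exact Hy.
    + apply (cover_sum_affine (fun z => A ((z - p) / c)) (- p / c) (/ c)); [|exact Hs].
      apply Rinv_neq_0_compat, Hc.
Qed.

Lemma lebesgue_union_le A B : bounded A -> bounded B ->
  lebesgue (fun x => A x \/ B x) <= lebesgue A + lebesgue B.
Proof.
  intros HA HB. set (U := lebesgue (fun x => A x \/ B x)).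
  enough (U - lebesgue A <= lebesgue B) by lra.
  apply lebesgue_ge; [exact HB|]. intros s2 Hs2.
  enough (U - s2 <= lebesgue A) by lra.
  apply lebesgue_ge; [exact HA|]. intros s1 Hs1.
  enough (U <= s1 + s2) by lra.
  apply lebesgue_le_cover; [apply bounded_union; auto|apply cover_sum_union; auto].
Qed.

Lemma clipped_lengths_sum a b c : a <= b ->
  Rmax 0 (Rmin b c - a) + Rmax 0 (b - Rmax a c) = b - a.
Proof. intro H. unfold Rmax, Rmin. repeat destruct Rle_dec; lra. Qed.

Lemma cover_sum_split X c s : cover_sum X s -> exists s1 s2, s1 + s2 = s /\
  cover_sum (fun x => X x /\ x < c) s1 /\ cover_sum (fun x => X x /\ c < x) s2.
Proof.
  intros [a [b [Hab [Hcov Hs]]]].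
  set (l1 := fun i => Rmax 0 (Rmin (b i) c - a i)).
  set (l2 := fun i => Rmax 0 (b i - Rmax (a i) c)).
  assert (Hsum : forall i, l1 i + l2 i = b i - a i) by (intro; apply clipped_lengths_sum, Hab).
  assert (Hl1 : forall i, 0 <= l1 i <= b i - a i).
  { intro i. pose proof (Hsum i). pose proof (Rmax_l 0 (Rmin (b i) c - a i)).
    pose proof (Rmax_l 0 (b i - Rmax (a i) c)). unfold l1, l2 in *. lra. }
  assert (Hl2 : forall i, 0 <= l2 i <= b i - a i).
  { intro i. pose proof (Hsum i). pose proof (Rmax_l 0 (Rmin (b i) c - a i)).
    pose proof (Rmax_l 0 (b i - Rmax (a i) c)). unfold l1, l2 in *. lra. }
  destruct (Rseries_CV_comp l1 _ Hl1 (exist _ s Hs)) as [s1 Hs1].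
  destruct (Rseries_CV_comp l2 _ Hl2 (exist _ s Hs)) as [s2 Hs2].
  exists s1, s2. split; [|split].
  - apply (UL_sequence (fun n => sum_f_R0 (fun i => b i - a i) n)); [|exact Hs].
    apply (Un_cv_ext (fun n => sum_f_R0 l1 n + sum_f_R0 l2 n)); [|apply CV_plus; auto].
    intro n. rewrite <- sum_plus. apply sum_eq. intros i _. apply Hsum.
  - exists a, (fun i => a i + l1 i). split; [intro i; pose proof (Hl1 i); lra|]. split.
    + intros x [Hx Hxc]. destruct (Hcov x Hx) as [i Hi]. exists i.
      pose proof (Rmax_r 0 (Rmin (b i) c - a i)). unfold l1.
      unfold Rmin in *. destruct Rle_dec; lra.
    + eapply infinite_sum_ext; [|exact Hs1]. intro i. simpl. ring.
  - exists (fun i => b i - l2 i), b. split; [intro i; pose proof (Hl2 i); lra|]. split.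
    + intros x [Hx Hxc]. destruct (Hcov x Hx) as [i Hi]. exists i.
      pose proof (Rmax_r 0 (b i - Rmax (a i) c)). unfold l2.
      unfold Rmax in *. destruct (Rle_dec (a i) c); lra.
    + eapply infinite_sum_ext; [|exact Hs2]. intro i. simpl. ring.
Qed.

Lemma lebesgue_union_separated A B c : bounded A -> bounded B ->
  (forall x, A x -> x <= c) -> (forall x, B x -> c <= x) ->
  lebesgue (fun x => A x \/ B x) = lebesgue A + lebesgue B.
Proof.
  intros HA HB HAc HBc. apply Rle_antisym; [apply lebesgue_union_le; auto|].
  apply lebesgue_ge; [apply bounded_union; auto|]. intros s Hs.
  apply le_epsilon. intros e He.
  destruct (cover_sum_split _ c _ Hs) as [s1 [s2 [Hs12 [Hs1 Hs2]]]].
  (* the clipped open intervals miss [c] itself *)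
  assert (Hpt := cover_sum_interval (c - e / 4) (c + e / 4) ltac:(lra)).
  assert (CA : cover_sum A (s1 + (c + e / 4 - (c - e / 4)))).
  { eapply cover_sum_mono; [|exact (cover_sum_union _ _ _ _ Hs1 Hpt)].
    intros x Hx. destruct (Req_dec x c) as [->|Hxc]; [right; lra|].
    left. split; [left; exact Hx|]. specialize (HAc x Hx). lra. }
  assert (CB : cover_sum B (s2 + (c + e / 4 - (c - e / 4)))).
  { eapply cover_sum_mono; [|exact (cover_sum_union _ _ _ _ Hs2 Hpt)].
    intros x Hx. destruct (Req_dec x c) as [->|Hxc]; [right; lra|].
    left. split; [right; exact Hx|]. specialize (HBc x Hx). lra. }
  pose proof (lebesgue_le_cover A _ HA CA). pose proof (lebesgue_le_cover B _ HB CB). lra.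
Qed.

(** * Concave functions on [0,1] *)

Definition nondecreasing_on (m : R) (f : R -> R) : Prop :=
  forall x y, 0 <= x -> x <= y -> y <= m -> f x <= f y.

Definition concave_on01 (f : R -> R) : Prop :=
  forall x y th, 0 <= x <= 1 -> 0 <= y <= 1 -> 0 <= th <= 1 ->
  th * f x + (1 - th) * f y <= f (th * x + (1 - th) * y).

Lemma concave_on01_reflect f : concave_on01 f -> concave_on01 (fun a => f (1 - a)).
Proof.
  intros Hf x y th Hx Hy Hth.
  replace (1 - (th * x + (1 - th) * y)) with (th * (1 - x) + (1 - th) * (1 - y)) by ring.
  apply Hf; lra.
Qed.

Lemma concave_on01_add f g :
  concave_on01 f -> concave_on01 g -> concave_on01 (fun a => f a + g a).
Proof.
  intros Hf Hg x y th Hx Hy Hth.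
  specialize (Hf x y th Hx Hy Hth). specialize (Hg x y th Hx Hy Hth). lra.
Qed.

(* With [z = th x + (1-th) y] and [p = th (1-x) / (1-z)], the left-hand side
   is [(1-z) (p f x + (1-p) f y)], and [p x + (1-p) y <= z]. *)
Lemma concave_on01_mul_compl f : nondecreasing_on 1 f -> concave_on01 f ->
  concave_on01 (fun a => (1 - a) * f a).
Proof.
  intros Hi Hc x y th Hx Hy Hth. set (z := th * x + (1 - th) * y).
  assert (Hz : 0 <= z <= 1) by (unfold z; nra).
  destruct (Req_dec z 1) as [Ez|Ez].
  - assert (E1 : th * (1 - x) = 0) by (unfold z in Ez; nra).
    assert (E2 : (1 - th) * (1 - y) = 0) by (unfold z in Ez; nra).
    rewrite Ez. replace (th * ((1 - x) * f x)) with (th * (1 - x) * f x) by ring.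
    replace ((1 - th) * ((1 - y) * f y)) with ((1 - th) * (1 - y) * f y) by ring.
    rewrite E1, E2. lra.
  - assert (Hz1 : 0 < 1 - z) by lra.
    set (p := th * (1 - x) / (1 - z)).
    assert (Hp : 0 <= p <= 1).
    { unfold p. split; [apply Rdiv_ge0; nra|]. apply Rdiv_le_l; [lra|]. unfold z; nra. }
    assert (Hq : 1 - p = (1 - th) * (1 - y) / (1 - z)) by (unfold p, z in *; field; lra).
    assert (Hm : p * x + (1 - p) * y <= z).
    { rewrite Hq. unfold p.
      replace (th * (1 - x) / (1 - z) * x + (1 - th) * (1 - y) / (1 - z) * y)
        with ((th * (1 - x) * x + (1 - th) * (1 - y) * y) / (1 - z)) by (field; lra).
      apply Rdiv_le_l; [lra|].
      assert (z * (1 - z) - (th * (1 - x) * x + (1 - th) * (1 - y) * y)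
              = th * (1 - th) * ((x - y) * (x - y))) by (unfold z; ring).
      assert (0 <= th * (1 - th) * ((x - y) * (x - y)))
        by (apply Rmult_le_pos; [nra|apply Rle_0_sqr]).
      nra. }
    assert (E : th * ((1 - x) * f x) + (1 - th) * ((1 - y) * f y)
                = (1 - z) * (p * f x + (1 - p) * f y)) by (rewrite Hq; unfold p; field; lra).
    rewrite E. apply Rmult_le_compat_l; [lra|].
    eapply Rle_trans; [apply Hc; auto|]. apply Hi; nra.
Qed.

Lemma concave_on01_symmetric_nondecreasing h : concave_on01 h ->
  (forall a, h (1 - a) = h a) -> nondecreasing_on (1 / 2) h.
Proof.
  intros Hh Hsym x y Hx Hxy Hy.
  destruct (Req_dec x (1 / 2)) as [Ex|Ex]; [replace y with x by lra; lra|].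
  (* [y] is a convex combination of [x] and [1 - x], where [h] takes the same value *)
  set (th := (1 - x - y) / (1 - 2 * x)).
  assert (Hth : 0 <= th <= 1).
  { unfold th. split; [apply Rdiv_ge0; lra|]. apply Rdiv_le_l; lra. }
  assert (Ey : y = th * x + (1 - th) * (1 - x)) by (unfold th; field; lra).
  pose proof (Hh x (1 - x) th ltac:(lra) ltac:(lra) Hth) as H.
  rewrite Hsym in H. rewrite Ey. lra.
Qed.

Lemma concave_on01_comp h g m : 0 <= m <= 1 ->
  nondecreasing_on m h -> concave_on01 h ->
  nondecreasing_on 1 g -> concave_on01 g -> (forall t, 0 <= t <= 1 -> 0 <= g t <= m) ->
  nondecreasing_on 1 (fun t => h (g t)) /\ concave_on01 (fun t => h (g t)).
Proof.
  intros Hm Hhi Hhc Hgi Hgc Hg. split.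
  - intros x y Hx Hxy Hy. apply Hhi.
    + apply Hg; lra.
    + apply Hgi; lra.
    + apply Hg; lra.
  - intros x y th Hx Hy Hth.
    pose proof (Hg x Hx). pose proof (Hg y Hy).
    pose proof (Hg (th * x + (1 - th) * y) ltac:(nra)).
    eapply Rle_trans; [apply Hhc; lra|].
    apply Hhi; [nra|apply Hgc; auto|lra].
Qed.

Definition mobius (c t : R) : R := t / (c + t).

Lemma mobius_nondecreasing c : 0 < c -> nondecreasing_on 1 (mobius c).
Proof.
  intros Hc x y Hx Hxy Hy. unfold mobius.
  apply Rle_div_r; [lra|].
  replace (x / (c + x) * (c + y)) with (x * (c + y) / (c + x)) by (field; lra).
  apply Rdiv_le_l; [lra|]. nra.
Qed.

(* [mobius c t = 1 - c / (c + t)], and [t |-> 1 / (c + t)] is convex. *)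
Lemma mobius_concave c : 0 < c -> concave_on01 (mobius c).
Proof.
  intros Hc x y th Hx Hy Hth. unfold mobius.
  set (X := c + x). set (Y := c + y).
  assert (HX : 0 < X) by (unfold X; lra). assert (HY : 0 < Y) by (unfold Y; lra).
  replace (c + (th * x + (1 - th) * y)) with (th * X + (1 - th) * Y) by (unfold X, Y; ring).
  assert (HZ : 0 < th * X + (1 - th) * Y) by nra.
  replace x with (X - c) by (unfold X; ring). replace y with (Y - c) by (unfold Y; ring).
  replace (th * (X - c) + (1 - th) * (Y - c)) with (th * X + (1 - th) * Y - c) by ring.
  replace ((X - c) / X) with (1 - c / X) by (field; lra).
  replace ((Y - c) / Y) with (1 - c / Y) by (field; lra).
  replace ((th * X + (1 - th) * Y - c) / (th * X + (1 - th) * Y))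
    with (1 - c / (th * X + (1 - th) * Y)) by (field; lra).
  enough (c / (th * X + (1 - th) * Y) <= th * (c / X) + (1 - th) * (c / Y)) by lra.
  replace (th * (c / X) + (1 - th) * (c / Y)) with (c * (th * Y + (1 - th) * X) / (X * Y))
    by (field; lra).
  apply Rdiv_le_l; [lra|].
  replace (c * (th * Y + (1 - th) * X) / (X * Y) * (th * X + (1 - th) * Y))
    with (c * ((th * Y + (1 - th) * X) * (th * X + (1 - th) * Y)) / (X * Y)) by (field; lra).
  apply Rle_div_r; [nra|].
  assert ((th * Y + (1 - th) * X) * (th * X + (1 - th) * Y) - X * Y
          = th * (1 - th) * ((X - Y) * (X - Y))) by ring.
  assert (0 <= th * (1 - th) * ((X - Y) * (X - Y)))
    by (apply Rmult_le_pos; [nra|apply Rle_0_sqr]).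
  nra.
Qed.

Definition sym_mix (f : R -> R) (a : R) : R := (1 - a) * f a + a * f (1 - a).

Definition farey_mass_step (f : R -> R) (t : R) : R := sym_mix f (mobius 1 t).

Definition farey_mass (u : R) (k : nat) : R -> R :=
  Nat.iter k farey_mass_step (mobius (u / (1 - u))).

Lemma mobius_1_range t : 0 <= t <= 1 -> 0 <= mobius 1 t <= 1 / 2.
Proof.
  intros Ht. unfold mobius. split; [apply Rdiv_ge0; lra|]. apply Rdiv_le_l; lra.
Qed.

Lemma farey_mass_step_preserves f : nondecreasing_on 1 f -> concave_on01 f ->
  nondecreasing_on 1 (farey_mass_step f) /\ concave_on01 (farey_mass_step f).
Proof.
  intros Hi Hc.
  assert (Hh : concave_on01 (sym_mix f)).
  { replace (sym_mix f) with
      (fun a => (1 - a) * f a + (fun b => (1 - b) * f b) (1 - a)).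
    - assert (Hg := concave_on01_mul_compl f Hi Hc).
      exact (concave_on01_add _ _ Hg (concave_on01_reflect _ Hg)).
    - apply functional_extensionality. intro a. unfold sym_mix. ring_simplify. reflexivity. }
  assert (Hsym : forall a, sym_mix f (1 - a) = sym_mix f a).
  { intro a. unfold sym_mix. replace (1 - (1 - a)) with a by ring. ring. }
  apply (concave_on01_comp (sym_mix f) (mobius 1) (1 / 2)); auto.
  - lra.
  - apply concave_on01_symmetric_nondecreasing; auto.
  - apply mobius_nondecreasing; lra.
  - apply mobius_concave; lra.
  - apply mobius_1_range.
Qed.

Lemma farey_mass_nondecreasing_concave u k : 0 < u < 1 ->
  nondecreasing_on 1 (farey_mass u k) /\ concave_on01 (farey_mass u k).
Proof.
  intro Hu. induction k as [|k [Hi Hc]].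
  - assert (Hc : 0 < u / (1 - u)) by (apply Rdiv_lt_0_compat; lra).
    split; [apply mobius_nondecreasing | apply mobius_concave]; exact Hc.
  - apply farey_mass_step_preserves; auto.
Qed.

Lemma farey_mass_succ_at_1 u k : 0 < u < 1 -> farey_mass u (S k) 1 <= farey_mass u k 1.
Proof.
  intro Hu. change (farey_mass u (S k) 1) with (farey_mass_step (farey_mass u k) 1).
  unfold farey_mass_step, sym_mix, mobius.
  replace (1 / (1 + 1)) with (1 / 2) by field. replace (1 - 1 / 2) with (1 / 2) by field.
  destruct (farey_mass_nondecreasing_concave u k Hu) as [Hi _].
  assert (farey_mass u k (1 / 2) <= farey_mass u k 1) by (apply Hi; lra).
  lra.
Qed.

(** * Farey preimages *)

Lemma farey_left x : 0 <= x <= 1 / 2 -> farey x = x / (1 - x).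
Proof. intros H. unfold farey. destruct Rle_dec; [reflexivity|lra]. Qed.

Lemma farey_right x : 1 / 2 <= x <= 1 -> farey x = (1 - x) / x.
Proof.
  intros H. unfold farey. destruct Rle_dec; [|reflexivity].
  replace x with (1 / 2) by lra. field.
Qed.

Definition psi (t z : R) : R := t * z / (1 - z * (1 - t)).

Lemma psi_1 z : psi 1 z = z.
Proof. unfold psi. field. Qed.

Lemma farey_psi_left t z : 0 < t <= 1 -> 0 <= z -> z * (1 + t) <= 1 ->
  farey (psi t z) = psi (mobius 1 t) (z / (1 - mobius 1 t)).
Proof.
  intros Ht Hz0 Hz1.
  assert (HD : 0 < 1 - z * (1 - t)) by nra.
  rewrite farey_left.
  - unfold psi, mobius. field. repeat split; nra.
  - unfold psi. split; [apply Rdiv_ge0; nra|]. apply Rdiv_le_l; nra.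
Qed.

Lemma farey_psi_right t z : 0 < t <= 1 -> 1 <= z * (1 + t) -> z <= 1 ->
  farey (psi t z) = psi (1 - mobius 1 t) ((1 - z) / mobius 1 t).
Proof.
  intros Ht Hz0 Hz1.
  assert (HD : 0 < 1 - z * (1 - t)) by nra.
  rewrite farey_right.
  - unfold psi, mobius. field. repeat split; nra.
  - unfold psi. split; [apply Rle_div_r; nra|]. apply Rdiv_le_l; nra.
Qed.

Definition unit_interval (z : R) : Prop := 0 <= z <= 1.

Definition psi_preimage (u : R) (k : nat) (t z : R) : Prop :=
  unit_interval z /\ u <= farey_iter k (psi t z) <= 1.

Lemma bounded_in_unit_interval A : (forall z, A z -> unit_interval z) -> bounded A.
Proof.
  intros HA. exists 1. intros z Hz. destruct (HA z Hz). apply Rabs_le. lra.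
Qed.

Lemma psi_preimage_0 u t z : 0 < u < 1 -> 0 < t <= 1 ->
  psi_preimage u 0 t z <-> u / (u + t * (1 - u)) <= z <= 1.
Proof.
  intros Hu Ht. unfold psi_preimage, unit_interval, psi, farey_iter. simpl.
  assert (HD : 0 < u + t * (1 - u)) by nra.
  split.
  - intros [Hz [H1 _]]. apply Rle_div_r in H1; [|nra].
    split; [apply Rdiv_le_l; nra|apply Hz].
  - intros [H1 H2]. apply Rdiv_le_l in H1; [|exact HD].
    assert (Hp : 0 <= u / (u + t * (1 - u))) by (apply Rdiv_ge0; lra).
    split; [split; nra|]. split; [apply Rle_div_r|apply Rdiv_le_l]; nra.
Qed.

Lemma psi_preimage_S u k t z : 0 < t <= 1 ->
  psi_preimage u (S k) t z <->
  psi_preimage u k (mobius 1 t) (z / (1 - mobius 1 t)) \/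
  psi_preimage u k (1 - mobius 1 t) ((1 - z) / mobius 1 t).
Proof.
  intros Ht. set (a := mobius 1 t).
  assert (Ha : 1 - a = 1 / (1 + t)) by (unfold a, mobius; field; lra).
  assert (Ha0 : 0 < a) by (unfold a, mobius; apply Rdiv_lt_0_compat; lra).
  assert (Ha1 : 0 < 1 - a) by (rewrite Ha; apply Rdiv_lt_0_compat; lra).
  assert (Hsplit : z * (1 + t) <= 1 <-> z <= 1 - a) by (rewrite Ha, Rle_div_r; lra).
  assert (Hl : unit_interval (z / (1 - a)) <-> 0 <= z <= 1 - a).
  { unfold unit_interval. rewrite Rle_div_r, Rdiv_le_l by exact Ha1. lra. }
  assert (Hr : unit_interval ((1 - z) / a) <-> 1 - a <= z <= 1).
  { unfold unit_interval. rewrite Rle_div_r, Rdiv_le_l by exact Ha0. lra. }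
  unfold psi_preimage, farey_iter. rewrite Nat.iter_succ_r. fold (farey_iter k).
  split.
  - intros [[Hz0 Hz1] Hf]. destruct (Rle_dec (z * (1 + t)) 1) as [Hle|Hgt].
    + left. rewrite (farey_psi_left t z Ht Hz0 Hle) in Hf.
      split; [apply Hl; split; [exact Hz0|apply Hsplit, Hle]|exact Hf].
    + right. rewrite (farey_psi_right t z Ht ltac:(lra) Hz1) in Hf.
      split; [apply Hr; split; [|exact Hz1]|exact Hf].
      assert (~ z <= 1 - a) by (rewrite <- Hsplit; exact Hgt). lra.
  - intros [[Hw Hf]|[Hw Hf]].
    + apply Hl in Hw. assert (Hle : z * (1 + t) <= 1) by (apply Hsplit; lra).
      rewrite (farey_psi_left t z Ht ltac:(lra) Hle).
      split; [split; lra|exact Hf].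
    + apply Hr in Hw. assert (Hge : 1 <= z * (1 + t)).
      { destruct (Req_dec z (1 - a)) as [->|Hne]; [rewrite Ha; right; field; lra|].
        enough (~ z * (1 + t) <= 1) by lra. rewrite Hsplit. lra. }
      rewrite (farey_psi_right t z Ht Hge ltac:(lra)).
      split; [split; lra|exact Hf].
Qed.

Lemma bounded_psi_preimage u k t : bounded (psi_preimage u k t).
Proof. apply bounded_in_unit_interval. intros z Hz. apply Hz. Qed.

Lemma lebesgue_psi_preimage_0 u t : 0 < u < 1 -> 0 < t <= 1 ->
  lebesgue (psi_preimage u 0 t) = mobius (u / (1 - u)) t * lebesgue unit_interval.
Proof.
  intros Hu Ht. set (p := u / (u + t * (1 - u))).
  assert (HD : 0 < u + t * (1 - u)) by nra.
  assert (Hp : 1 - p = mobius (u / (1 - u)) t) by (unfold p, mobius; field; lra).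
  assert (Hp0 : 0 < 1 - p).
  { rewrite Hp. unfold mobius. apply Rdiv_lt_0_compat; [lra|].
    enough (0 < u / (1 - u)) by lra. apply Rdiv_lt_0_compat; lra. }
  rewrite (lebesgue_ext _ (fun z => unit_interval ((z - p) / (1 - p)))).
  - rewrite (lebesgue_affine unit_interval p (1 - p) (fun z => (z - p) / (1 - p)));
      [|lra|apply bounded_in_unit_interval; auto|reflexivity].
    rewrite Rabs_right, Hp by lra. reflexivity.
  - intro z. rewrite psi_preimage_0 by auto. fold p. unfold unit_interval.
    rewrite Rle_div_r, Rdiv_le_l by exact Hp0. lra.
Qed.

Lemma lebesgue_psi_preimage_S u k t : 0 < t <= 1 ->
  lebesgue (psi_preimage u (S k) t) =
  (1 - mobius 1 t) * lebesgue (psi_preimage u k (mobius 1 t)) +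
  mobius 1 t * lebesgue (psi_preimage u k (1 - mobius 1 t)).
Proof.
  intros Ht. set (a := mobius 1 t).
  assert (Ha : 0 < a <= 1 / 2).
  { pose proof (mobius_1_range t ltac:(lra)) as Hr. split; [|apply Hr].
    unfold a, mobius. apply Rdiv_lt_0_compat; lra. }
  set (A := fun z => psi_preimage u k a (z / (1 - a))).
  set (B := fun z => psi_preimage u k (1 - a) ((1 - z) / a)).
  assert (HA : forall z, A z -> 0 <= z <= 1 - a).
  { intros z [[H0 H1] _]. apply Rle_div_r in H0; [|lra]. apply Rdiv_le_l in H1; lra. }
  assert (HB : forall z, B z -> 1 - a <= z <= 1).
  { intros z [[H0 H1] _]. apply Rle_div_r in H0; [|lra]. apply Rdiv_le_l in H1; lra. }
  assert (HAb : bounded A).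
  { apply bounded_in_unit_interval. intros z Hz. specialize (HA z Hz). unfold unit_interval. lra. }
  assert (HBb : bounded B).
  { apply bounded_in_unit_interval. intros z Hz. specialize (HB z Hz). unfold unit_interval. lra. }
  rewrite (lebesgue_ext _ (fun z => A z \/ B z)) by (intro; apply psi_preimage_S, Ht).
  rewrite (lebesgue_union_separated A B (1 - a) HAb HBb
             (fun z Hz => proj2 (HA z Hz)) (fun z Hz => proj1 (HB z Hz))).
  unfold A, B.
  rewrite (lebesgue_affine _ 0 (1 - a) (fun z => z / (1 - a)));
    [|lra|apply bounded_psi_preimage|intro z; rewrite Rminus_0_r; reflexivity].
  rewrite (lebesgue_affine _ 1 (- a) (fun z => (1 - z) / a));
    [|lra|apply bounded_psi_preimage|intro z; field; lra].
  rewrite Rabs_right, Rabs_left, Ropp_involutive by lra. reflexivity.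
Qed.

(* The factor [lebesgue unit_interval] (which is 1) is carried along: the
   argument never needs its value. *)
Lemma lebesgue_psi_preimage u k t : 0 < u < 1 -> 0 < t <= 1 ->
  lebesgue (psi_preimage u k t) = farey_mass u k t * lebesgue unit_interval.
Proof.
  intros Hu. revert t. induction k as [|k IH]; intros t Ht.
  - apply lebesgue_psi_preimage_0; auto.
  - pose proof (mobius_1_range t ltac:(lra)) as Ha.
    assert (Ha0 : 0 < mobius 1 t) by (unfold mobius; apply Rdiv_lt_0_compat; lra).
    rewrite lebesgue_psi_preimage_S, !IH by (auto; lra).
    change (farey_mass u (S k) t) with (farey_mass_step (farey_mass u k) t).
    unfold farey_mass_step, sym_mix. ring.
Qed.

Lemma Cset_succ u m z : Cset u (S m) z <-> psi_preimage u m 1 z.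
Proof.
  unfold Cset, farey_preimage, psi_preimage, unit_interval.
  replace (S m - 1)%nat with m by lia. rewrite psi_1. reflexivity.
Qed.

Theorem theorem2 (u : R) (hu : 0 < u < 1) (n : nat) (hn : (1 <= n)%nat) :
  lebesgue (Cset u (S n)) <= lebesgue (Cset u n).
Proof.
  destruct n as [|m]; [lia|].
  rewrite !(lebesgue_ext _ _ (Cset_succ u _)).
  rewrite !lebesgue_psi_preimage by (auto; lra).
  apply Rmult_le_compat_r.
  - apply lebesgue_ge0, bounded_in_unit_interval. auto.
  - apply farey_mass_succ_at_1, hu.
Qed.
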